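(* Let $\mathfrak A$ be an $\aleph_0$-categorical structure and let $R\subseteq A^\ell$ be a relation over its universe. Then the set of all tuples $\bar a\in A^\ell$ such that there exist $k\ge1$ and $\bar a_0,\dots,\bar a_{k-1}\in R$ for which $\bar a$ is a surjective periomorphic image of $(\bar a_i)_{i<k}$, is the smallest positive Horn definable (in $\mathfrak A$) relation containing $R$.
   Context: $\mathfrak A$ is a structure in a countable first-order language (relation, constant and function symbols allowed; equality and $\bot$ included). A positive Horn formula is built from atomic formulas using only $\wedge,\exists,\forall$; a relation is positive Horn definable in $\mathfrak A$ if it equals $\{\bar a:\mathfrak A\models\varphi(\bar a)\}$ for some positive Horn $\varphi$. $\aleph_0$-categorical: countable, and every countable structure with the same first-order theory is isomorphic to it. A function $\vec a:\mathbb N\to A$ is periodic if for some $k\ge1$, $\vec a(i)=\vec a(i\bmod k)$ for all $i$; for $a_0,\dots,a_{k-1}\in A$, $\langle a_0\cdots a_{k-1}\rangle$ denotes the periodic function $i\mapsto a_{i\bmod k}$. The periodic power $\mathfrak A^{\mathrm{per}}$ is the substructure of $\mathfrak A^{\mathbb N}$ on the periodic functions; a periomorphism is a homomorphism $\mathfrak A^{\mathrm{per}}\to\mathfrak A$. If $\bar a_i=(a_i^0,\dots,a_i^{\ell-1})$ for $i<k$, a tuple $\bar b\in A^\ell$ is a surjective periomorphic image of $(\bar a_i)_{i<k}$ if there is a surjective periomorphism $h$ of $\mathfrak A$ with $\bar b=(h(\langle a_0^0a_1^0\cdots a_{k-1}^0\rangle),\dots,h(\langle a_0^{\ell-1}\cdots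 a_{k-1}^{\ell-1}\rangle))$. *)

(* Defs.v *)
From mathcomp Require Import all_boot.
From mathcomp Require Import classical_sets cardinality.

Set Implicit Arguments.
Unset Strict Implicit.
Unset Printing Implicit Defensive.

Local Open Scope classical_set_scope.

(* Constants are function symbols of arity 0. *)
Record language := Language {
  fun_symbol : countType;
  fun_arity : fun_symbol -> nat;
  rel_symbol : countType;
  rel_arity : rel_symbol -> nat
}.

Record structure (L : language) := Structure {
  carrier :> Type;
  carrier_inhabited : inhabited carrier;
  fun_interp : forall f : fun_symbol L, ('I_(fun_arity f) -> carrier) -> carrier;
  rel_interp : forall r : rel_symbol L, set ('I_(rel_arity r) -> carrier)
}.

Section Syntax.
Variable L : language.

(* [term n] and [formula n] have their free variables among x_0, ..., x_(n-1),
   represented by 'I_n.  A quantifier binds variable ord0 of its body, in which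
   x_i is renamed to [lift ord0 i]. *)
Inductive term (n : nat) : Type :=
| Var of 'I_n
| App (f : fun_symbol L) of ('I_(fun_arity f) -> term n).

Inductive formula : nat -> Type :=
| Bot n : formula n
| Eq n : term n -> term n -> formula n
| Rel n (r : rel_symbol L) : ('I_(rel_arity r) -> term n) -> formula n
| Imp n : formula n -> formula n -> formula n
| And n : formula n -> formula n -> formula n
| Or n : formula n -> formula n -> formula n
| Ex n : formula n.+1 -> formula n
| All n : formula n.+1 -> formula n.

Fixpoint positive_horn n (phi : formula n) : bool :=
  match phi with
  | Bot _ | Eq _ _ _ | Rel _ _ _ => true
  | And _ p q => positive_horn p && positive_horn q
  | Ex _ p | All _ p => positive_horn p
  | Imp _ _ _ | Or _ _ _ => false
  end.

End Syntax.

Section Semantics.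
Variables (L : language) (A : structure L).

Fixpoint eval n (v : 'I_n -> A) (t : term L n) : A :=
  match t with
  | Var i => v i
  | App f args => fun_interp (fun i => eval v (args i))
  end.

Definition extend n (x : A) (v : 'I_n -> A) : 'I_n.+1 -> A :=
  fun i => oapp v x (unlift ord0 i).

Fixpoint holds n (phi : formula L n) : ('I_n -> A) -> Prop :=
  match phi in formula _ m return ('I_m -> A) -> Prop with
  | Bot _ => fun=> False
  | Eq _ s t => fun v => eval v s = eval v t
  | Rel _ r args => fun v => rel_interp (fun i => eval v (args i))
  | Imp _ p q => fun v => holds p v -> holds q v
  | And _ p q => fun v => holds p v /\ holds q v
  | Or _ p q => fun v => holds p v \/ holds q v
  | Ex _ p => fun v => exists x : A, holds p (extend x v)
  | All _ p => fun v => forall x : A, holds p (extend x v)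
  end.

Definition positive_horn_definable l (R : set ('I_l -> A)) : Prop :=
  exists2 phi : formula L l, positive_horn phi & R = [set v | holds phi v].

Definition smallest_positive_horn_definable l (R S : set ('I_l -> A)) : Prop :=
  [/\ positive_horn_definable S,
      R `<=` S
    & forall T, positive_horn_definable T -> R `<=` T -> S `<=` T].

End Semantics.

Section Morphisms.
Variables (L : language) (A B : structure L).

Definition homomorphism (h : A -> B) : Prop :=
  (forall (f : fun_symbol L) (x : 'I_(fun_arity f) -> A),
      h (fun_interp x) = fun_interp (fun i => h (x i))) /\
  (forall (r : rel_symbol L) (x : 'I_(rel_arity r) -> A),
      rel_interp x -> rel_interp (fun i => h (x i))).

Definition isomorphism (h : A -> B) : Prop :=
  [/\ bijective h,
      forall (f : fun_symbol L) (x : 'I_(fun_arity f) -> A),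
        h (fun_interp x) = fun_interp (fun i => h (x i))
    & forall (r : rel_symbol L) (x : 'I_(rel_arity r) -> A),
        rel_interp x <-> rel_interp (fun i => h (x i))].

Definition elementarily_equivalent : Prop :=
  forall (phi : formula L 0) (v : 'I_0 -> A) (w : 'I_0 -> B),
    holds phi v <-> holds phi w.

End Morphisms.

(* [countable] means finite or countably infinite. *)
Definition aleph0_categorical L (A : structure L) : Prop :=
  countable [set: A] /\
  forall B : structure L, countable [set: B] -> elementarily_equivalent A B ->
    exists h : A -> B, isomorphism h.

Definition direct_power L (A : structure L) (I : Type) : structure L :=
  {| carrier := I -> A;
     carrier_inhabited :=
       let: inhabits x := carrier_inhabited A in inhabits (fun=> x);
     fun_interp := fun f x i => fun_interp (fun j => x j i);
     rel_interp := fun r => [set x | forall i, rel_interp (fun j => x j i)] |}.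

Definition substructure L (A : structure L) (P : set A)
    (P_inhabited : inhabited {x : A | P x})
    (P_closed : forall (f : fun_symbol L) (x : 'I_(fun_arity f) -> A),
        (forall j, P (x j)) -> P (fun_interp x)) : structure L :=
  {| carrier := {x : A | P x};
     carrier_inhabited := P_inhabited;
     fun_interp := fun f x =>
       exist P (fun_interp (fun j => sval (x j)))
               (P_closed f _ (fun j => svalP (x j)));
     rel_interp := fun r => [set x | rel_interp (fun j => sval (x j))] |}.

Definition periodic (T : Type) : set (nat -> T) :=
  [set a | exists2 k, 0 < k & forall i, a i = a (i %% k)].

Arguments periodic : clear implicits.

Section PeriodicPower.
Variables (L : language) (A : structure L).

Lemma periodic_inhabited : inhabited {a : direct_power A nat | periodic A a}.
Proof.
by case: (carrier_inhabited A) => x; apply: inhabits; exists (fun=> x); exists 1.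
Qed.

Lemma periodic_closed (f : fun_symbol L)
    (x : 'I_(fun_arity f) -> direct_power A nat) :
  (forall j, periodic A (x j)) -> periodic A (fun_interp x).
Proof.
move=> px.
have /fin_all_exists [k kP] : forall j, exists k : nat,
    0 < k /\ forall i, x j i = x j (i %% k).
  by move=> j; have [k k0 kP] := px j; exists k.
exists (\prod_j k j); first by apply: prodn_gt0 => j; case: (kP j).
move=> i /=; congr fun_interp; apply: boolp.funext => j.
have [_ xk] := kP j; rewrite xk [RHS]xk modn_dvdm //.
by rewrite (bigD1 j) //= dvdn_mulr.
Qed.

Definition periodic_power : structure L :=
  substructure periodic_inhabited periodic_closed.

Lemma periodic_word_subproof k (k_gt0 : 0 < k) (a : 'I_k -> A) :
  periodic A (fun i => a (Ordinal (ltn_pmod i k_gt0))).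
Proof.
by exists k => // i; congr a; apply: val_inj; rewrite /= modn_mod.
Qed.

(* The periodic function <a_0 ... a_(k-1)>. *)
Definition periodic_word k (k_gt0 : 0 < k) (a : 'I_k -> A) : periodic_power :=
  exist _ _ (periodic_word_subproof k_gt0 a).

Definition periomorphism (h : periodic_power -> A) : Prop := homomorphism h.

Definition surjective_periomorphic_image k (k_gt0 : 0 < k) l
    (a : 'I_k -> 'I_l -> A) (b : 'I_l -> A) : Prop :=
  exists h : periodic_power -> A,
    [/\ periomorphism h,
        forall y, exists x, h x = y
      & b = fun j => h (periodic_word k_gt0 (fun i => a i j))].

End PeriodicPower.

(* Main.v *)
(* Positive Horn truth in the periodic power is coordinatewise, and it is preserved by
   surjective homomorphisms; this gives minimality.  For definability, aleph0-categoricity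
   provides finitely many types of n-tuples for each n (Ryll-Nardzewski).  Hence the
   positive Horn formulas true on R amount to a single one, and a tuple b satisfying it
   satisfies all positive Horn formulas true in the periodic power of the words built from
   representatives in R of the types met by R.  A back-and-forth then extends
   "words |-> b" to a surjective periomorphism.

   Ryll-Nardzewski: a countable elementary substructure of an ultrapower of A is isomorphic
   to A, so A realizes every type finitely satisfiable in it; as A is countable, isolated
   types are then dense, and A is isomorphic to an elementary substructure of itself all of
   whose tuples are isolated.  If infinitely many types were isolated, the negations of
   the isolating formulas would be jointly realized. *)
Require Import Defs.
From mathcomp Require Import all_boot.
From mathcomp Require Import boolp classical_sets cardinality filter.

Set Implicit Arguments.
Unset Strict Implicit.
Unset Printing Implicit Defensive.

Local Open Scope classical_set_scope.

(** * Countable types and their enumerations *)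

Lemma countable_setTP (T : Type) :
  countable [set: T] <-> exists c : T -> nat, injective c.
Proof.
split=> [/countable_injP[c cI]|[c cI]].
  by exists c => x y; apply: cI; rewrite inE.
by apply/countable_injP; exists c => x y _ _; apply: cI.
Qed.

Lemma inj_countable (S T : Type) (f : S -> T) :
  injective f -> countable [set: T] -> countable [set: S].
Proof.
move=> fI /countable_setTP[c cI]; apply/countable_setTP.
by exists (c \o f); apply: inj_comp.
Qed.

(** The values lie in [option T] because [T] may be empty, as closed terms are in a language without
    constants. *)
Lemma countable_option_enum (T : Type) : countable [set: T] ->
  exists d : nat -> option T, forall x, exists j, d j = Some x.
Proof.
move=> /countable_setTP[c cI].
exists (fun j => if pselect (exists x, c x = j) is left p
                 then Some (sval (cid p)) else None) => x.
exists (c x); case: pselect => [p|[]]; last by exists x.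
by congr Some; apply: cI; case: (cid p).
Qed.

Lemma surj_countable (S T : Type) (f : S -> option T) :
  (forall x, exists s, f s = Some x) -> countable [set: S] ->
  countable [set: T].
Proof.
move=> /choice[g gP]; apply: inj_countable (g) _ => x y gxy.
by apply: Some_inj; rewrite -!gP gxy.
Qed.

Lemma countable_enum (T : Type) : inhabited T -> countable [set: T] ->
  exists d : nat -> T, forall x, exists j, d j = x.
Proof.
move=> [x0] /countable_option_enum[d dP].
by exists (fun j => odflt x0 (d j)) => x; have [j dj] := dP x; exists j; rewrite dj.
Qed.

Lemma countable_seq (T : Type) : countable [set: T] -> countable [set: seq T].
Proof.
move=> /countable_setTP[c cI].
by apply: inj_countable (inj_map cI) _; apply: countableP.
Qed.

Lemma countable_tuples n (T : Type) :
  countable [set: T] -> countable [set: 'I_n -> T].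
Proof.
move=> /countable_setTP[c cI].
apply: inj_countable (fun f => [ffun i => c (f i)] : {ffun 'I_n -> nat}) _ _.
  by move=> f g /ffunP fg; apply/funext => i; apply: cI; have := fg i; rewrite !ffunE.
exact: countableP.
Qed.

(** * Countability of the syntax *)

Fixpoint term_tree L n (t : term L n) : GenTree.tree nat :=
  match t with
  | Var i => GenTree.Leaf (val i)
  | App f x => GenTree.Node (pickle f)
                 [seq term_tree (x i) | i <- enum 'I_(fun_arity f)]
  end.

Lemma term_tree_inj L n : injective (@term_tree L n).
Proof.
elim=> [i|f x IH] [j|g y] //= => [[/val_inj -> //]|[/(pcan_inj pickleK) fg]].
subst g => /eq_in_map xy; congr App; apply/funext => i.
by apply/IH/xy; rewrite mem_enum.
Qed.

Lemma countable_term L n : countable [set: term L n].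
Proof. by apply: inj_countable (@term_tree_inj L n) _; apply: countableP. Qed.

(** A decoder is used instead of an injective encoding because [formula] is an indexed family:
    surjectivity onto each [formula L m] needs no comparison of dependent arguments. Ill-formed
    trees go to [Bot]. *)
Fixpoint tree_formula L (dt : forall m, nat -> option (term L m))
    (da : forall m (r : rel_symbol L),
        nat -> option ('I_(rel_arity r) -> term L m))
    (t : GenTree.tree nat) m : formula L m :=
  match t with
  | GenTree.Node 0 [:: GenTree.Leaf i; GenTree.Leaf j] =>
      if (dt m i, dt m j) is (Some s, Some u) then Eq s u else Bot L m
  | GenTree.Node 1 [:: GenTree.Leaf i; GenTree.Leaf j] =>
      if unpickle i is Some r then
        if da m r j is Some x then Rel x else Bot L m
      else Bot L m
  | GenTree.Node 2 [:: p; q] => Imp (tree_formula dt da p m) (tree_formula dt da q m)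
  | GenTree.Node 3 [:: p; q] => And (tree_formula dt da p m) (tree_formula dt da q m)
  | GenTree.Node 4 [:: p; q] => Or (tree_formula dt da p m) (tree_formula dt da q m)
  | GenTree.Node 5 [:: p] => Ex (tree_formula dt da p m.+1)
  | GenTree.Node 6 [:: p] => All (tree_formula dt da p m.+1)
  | _ => Bot L m
  end.

Lemma countable_formula L n : countable [set: formula L n].
Proof.
pose dt m := cid (countable_option_enum (countable_term L m)).
pose da m (r : rel_symbol L) := cid (countable_option_enum
  (@countable_tuples (rel_arity r) _ (countable_term L m))).
pose dec := tree_formula (fun m => sval (dt m)) (fun m r => sval (da m r)).
suff decP m (phi : formula L m) : exists t, dec t m = phi.
  apply: (@surj_countable (GenTree.tree nat) _ (fun t => Some (dec t n))).
    by move=> phi; have [t <-] := decP _ phi; exists t.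
  exact: countableP.
elim: m / phi => [m|m s u|m r x|m p [t tp] q [u uq]|m p [t tp] q [u uq]
  |m p [t tp] q [u uq]|m p [t tp]|m p [t tp]].
- by exists (GenTree.Leaf 0).
- have [i si] := svalP (dt m) s; have [j uj] := svalP (dt m) u.
  by exists (GenTree.Node 0 [:: GenTree.Leaf i; GenTree.Leaf j]); rewrite /dec /= si uj.
- have [i xi] := svalP (da m r) x.
  exists (GenTree.Node 1 [:: GenTree.Leaf (pickle r); GenTree.Leaf i]).
  by rewrite /dec /= pickleK xi.
- by exists (GenTree.Node 2 [:: t; u]); rewrite -tp -uq.
- by exists (GenTree.Node 3 [:: t; u]); rewrite -tp -uq.
- by exists (GenTree.Node 4 [:: t; u]); rewrite -tp -uq.
- by exists (GenTree.Node 5 [:: t]); rewrite -tp.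
- by exists (GenTree.Node 6 [:: t]); rewrite -tp.
Qed.

(** * Renaming of variables *)

Definition lift_renaming n m (f : 'I_n -> 'I_m) (i : 'I_n.+1) : 'I_m.+1 :=
  oapp (fun j => lift ord0 (f j)) ord0 (unlift ord0 i).

Fixpoint rename_term L n m (f : 'I_n -> 'I_m) (t : term L n) : term L m :=
  match t with
  | Var i => Var L (f i)
  | App g x => App (fun i => rename_term f (x i))
  end.

Fixpoint rename L n (phi : formula L n) : forall m, ('I_n -> 'I_m) -> formula L m :=
  match phi in formula _ n return forall m, ('I_n -> 'I_m) -> formula L m with
  | Bot _ => fun m f => Bot L m
  | Eq _ s t => fun m f => Eq (rename_term f s) (rename_term f t)
  | Rel _ r x => fun m f => Rel (fun i => rename_term f (x i))
  | Imp _ p q => fun m f => Imp (rename p f) (rename q f)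
  | And _ p q => fun m f => And (rename p f) (rename q f)
  | Or _ p q => fun m f => Or (rename p f) (rename q f)
  | Ex _ p => fun m f => Ex (rename p (lift_renaming f))
  | All _ p => fun m f => All (rename p (lift_renaming f))
  end.

Lemma positive_horn_rename L n (phi : formula L n) m (f : 'I_n -> 'I_m) :
  positive_horn (rename phi f) = positive_horn phi.
Proof. by elim: phi m f => //= k p IHp q IHq m f; rewrite IHp IHq. Qed.

Definition vcons T n (x : T) (v : 'I_n -> T) (i : 'I_n.+1) : T :=
  oapp v x (unlift ord0 i).

Lemma vcons0 T n (x : T) (v : 'I_n -> T) : vcons x v ord0 = x.
Proof. by rewrite /vcons unlift_none. Qed.

Lemma vcons_lift T n (x : T) (v : 'I_n -> T) i :
  vcons x v (lift ord0 i) = v i.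
Proof. by rewrite /vcons liftK. Qed.

Lemma vcons_lift_renaming T n m (x : T) (v : 'I_m -> T) (f : 'I_n -> 'I_m) :
  vcons x v \o lift_renaming f = vcons x (v \o f).
Proof.
apply/funext => i; rewrite /= /lift_renaming /vcons.
by case: (unliftP ord0 i) => [j|] _ /=; rewrite ?liftK ?unlift_none.
Qed.

Lemma comp_vcons S T (h : S -> T) n (x : S) (v : 'I_n -> S) :
  h \o vcons x v = vcons (h x) (h \o v).
Proof. by apply/funext => i; rewrite /vcons /=; case: unlift. Qed.

Section Semantics.
Variables (L : language) (A : structure L).

Lemma extendE n (x : A) (v : 'I_n -> A) : extend x v = vcons x v.
Proof. by []. Qed.

Lemma eval_rename n m (f : 'I_n -> 'I_m) (t : term L n) (v : 'I_m -> A) :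
  eval v (rename_term f t) = eval (v \o f) t.
Proof. by elim: t => //= g x IH; congr fun_interp; apply/funext => i. Qed.

Lemma holds_rename n (phi : formula L n) m (f : 'I_n -> 'I_m) (v : 'I_m -> A) :
  holds (rename phi f) v <-> holds phi (v \o f).
Proof.
elim: n / phi m f v => [n|n s t|n r x|n p IHp q IHq|n p IHp q IHq
  |n p IHp q IHq|n p IH|n p IH] m f v //=.
- by rewrite !eval_rename.
- suff -> : (fun i => eval v (rename_term f (x i))) =
    (fun i => eval (v \o f) (x i)) by [].
  by apply/funext => i; rewrite eval_rename.
- by rewrite IHp IHq.
- by rewrite IHp IHq.
- by rewrite IHp IHq.
- by split=> -[x]; rewrite ?IH extendE => Hx; exists x; move: Hx;
    rewrite ?IH extendE vcons_lift_renaming.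
- by split=> H x; move: (H x); rewrite ?IH extendE vcons_lift_renaming.
Qed.

(** Truth as a positive Horn formula, in every language and for every [n], including 0. *)
Definition Top n : formula L n := All (Eq (Var L ord0) (Var L ord0)).

(** Through this atomic formula, closure under functions and compatibility with them become
    instances of the transfer of formulas. *)
Lemma holds_graph (f : fun_symbol L) (x : 'I_(fun_arity f) -> A) (y : A) :
  holds (Eq (Var L ord0) (App (fun i => Var L (lift ord0 i)))) (vcons y x) <->
  y = fun_interp x.
Proof.
rewrite /= vcons0; suff -> : (fun i => vcons y x (lift ord0 i)) = x by [].
by apply/funext => i; rewrite vcons_lift.
Qed.

Lemma holds_bigAnd n (I : finType) (F : I -> formula L n) (v : 'I_n -> A) :
  holds (\big[@And L n/Top n]_i F i) v <-> forall i, holds (F i) v.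
Proof.
suff {1}-> : holds (\big[@And L n/Top n]_i F i) v <->
    forall i, i \in index_enum I -> holds (F i) v.
  by split=> H i => [|_]; apply: H; rewrite mem_index_enum.
elim: (index_enum I) => [|i r IH]; first by rewrite big_nil; split.
rewrite big_cons /= IH; split=> [[Hi Hr] j /predU1P[->|/Hr] //|H].
by split=> [|j rj]; apply: H; rewrite inE ?eqxx ?rj ?orbT.
Qed.

(** The first variables are the bound ones: [k'.+1 + n] reduces to [(k' + n).+1], so no cast
    occurs. *)
Fixpoint exists_prefix k n : formula L (k + n) -> formula L n :=
  match k return formula L (k + n) -> formula L n with
  | 0 => id
  | k'.+1 => fun phi => exists_prefix (Ex phi)
  end.

Lemma holds_exists_prefix k n (phi : formula L (k + n)) (v : 'I_n -> A) :
  holds (exists_prefix phi) v <->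
  exists2 w : 'I_(k + n) -> A, w \o @rshift k n = v & holds phi w.
Proof.
elim: k phi v => [|k IH] phi v /=.
  have E (w : 'I_n -> A) : w \o @rshift 0 n = w.
    by apply/funext => i /=; congr w; apply: val_inj.
  by split=> [H|[w <-]]; [exists v; rewrite ?E|rewrite E].
rewrite IH; split=> [[w wv [x Hx]]|[w wv Hw]].
  exists (vcons x w) => //; rewrite -wv; apply/funext => i /=.
  by rewrite -[RHS](vcons_lift x); congr vcons; apply: val_inj.
exists (fun i => w (lift ord0 i)).
  by rewrite -wv; apply/funext => i /=; congr w; apply: val_inj.
exists (w ord0); rewrite extendE; move: Hw; congr (holds phi _).
by apply/funext => i; case: (unliftP ord0 i) => [j|] ->;
  rewrite ?vcons_lift ?vcons0.
Qed.

End Semantics.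

(** * Elementary substructures *)

Definition schedule (k : nat) : nat * nat :=
  let s := CodeSeq.decode k in (nth 0 s 0, nth 0 s 1).

(** The code of [[:: i; j]] exceeds [i], so requirement [(i, j)] comes up when state [i] is already
    built. *)
Lemma scheduleP i j : exists2 k, i <= k & schedule k = (i, j).
Proof.
exists (CodeSeq.code [:: i; j]); last by rewrite /schedule CodeSeq.codeK.
have := CodeSeq.gtn_decode (CodeSeq.code [:: i; j]).
by rewrite CodeSeq.codeK => /andP[/ltnW].
Qed.

(* Requirement [(i, j)] is stated about the [i]-th state and is met at some later state. *)
Lemma requirement_chain (S : Type) (P : S -> Prop) (le : S -> S -> Prop)
    (Q : nat -> S -> S -> Prop) (s0 : S) :
  P s0 -> (forall s, le s s) -> (forall s t u, le s t -> le t u -> le s u) ->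
  (forall j s t, le s t -> P t -> exists u, [/\ P u, le t u & Q j s u]) ->
  exists c : nat -> S,
    [/\ c 0 = s0, forall k, P (c k), forall i k, i <= k -> le (c i) (c k)
      & forall i j, exists k, Q j (c i) (c k)].
Proof.
move=> P0 le_refl le_trans step.
have /choice[nxt nxtP] (p : nat * S * S) : exists u,
    le p.1.2 p.2 -> P p.2 -> [/\ P u, le p.2 u & Q p.1.1 p.1.2 u].
  case: p => -[j s] t /=; case: (pselect (le s t /\ P t)) => [[st Pt]|n].
    by have [u uP] := step j s t st Pt; exists u.
  by exists t => st Pt; case: n.
(* Course-of-values recursion, since the next state depends on an earlier one: for [i <= k],
   [hist k i] is the [i]-th state, and [minn] keeps the index in this range. *)
pose fix hist k : nat -> S := if k is k'.+1 then fun i =>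
  if i <= k' then hist k' i else
    let: (a, j) := schedule k' in nxt (j, hist k' (minn a k'), hist k' k')
  else fun=> s0.
pose c k := hist k k.
have histE k i : i <= k -> hist k i = c i.
  elim: k i => [|k IH] i; first by rewrite leqn0 => /eqP ->.
  by rewrite leq_eqVlt => /predU1P[-> //|]; rewrite ltnS /= => ik; rewrite ik IH.
have cS k : c k.+1 = nxt ((schedule k).2, c (minn (schedule k).1 k), c k).
  transitivity (let: (a, j) := schedule k in nxt (j, hist k (minn a k), c k)).
    by rewrite {1}/c /= ltnn.
  by case: (schedule k) => a j; rewrite histE ?geq_minr.
have main k : P (c k) /\ forall i, i <= k -> le (c i) (c k).
  elim: k => [|k [Pk lek]]; first by split=> // i; rewrite leqn0 => /eqP ->.
  have := nxtP ((schedule k).2, c (minn (schedule k).1 k), c k).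
  rewrite -cS /= => /(_ (lek _ (geq_minr _ _)) Pk)[Pk1 lek1 _].
  split=> // i; rewrite leq_eqVlt => /predU1P[-> //|]; rewrite ltnS => /lek.
  by move/le_trans; apply.
exists c; split=> // [k|i k ik|i j]; [by case: (main k)|by case: (main k) => _; apply|].
have [k ik kij] := scheduleP i j; exists k.+1.
have [Pk lek] := main k.
have := nxtP ((schedule k).2, c (minn (schedule k).1 k), c k).
rewrite -cS kij /= (minn_idPl ik) => /(_ (lek _ ik) Pk)[_ _ //].
Qed.

Definition subtuple T (s t : {n & 'I_n -> T}) : Prop :=
  exists f : 'I_(tag s) -> 'I_(tag t), tagged s = tagged t \o f.

Lemma subtuple_refl T (s : {n & 'I_n -> T}) : subtuple s s.
Proof. by exists id. Qed.

Lemma subtuple_trans T (s t u : {n & 'I_n -> T}) :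
  subtuple s t -> subtuple t u -> subtuple s u.
Proof. by move=> [f sf] [g tg]; exists (g \o f); rewrite sf tg. Qed.

(** The maximum of the stages at which the entries of [v] occur contains them all. *)
Lemma subtuple_cover T (c : nat -> {n & 'I_n -> T}) n (v : 'I_n -> T) :
  (forall i k, i <= k -> subtuple (c i) (c k)) ->
  (forall i, exists k j, v i = tagged (c k) j) ->
  exists k (f : 'I_n -> 'I_(tag (c k))), v = tagged (c k) \o f.
Proof.
move=> c_mono /choice[k kP]; exists (\max_i k i).
suff /choice[f fP] i : exists j, v i = tagged (c (\max_i k i)) j.
  by exists f; apply/funext.
have [j ->] := kP i; have [f ->] := c_mono _ _ (leq_bigmax (F := k) i).
by exists (f j).
Qed.

(** The universe of [B] is the union of an increasing chain of finite tuples, each satisfying the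
    invariant [P], that acquires witnesses for all existential formulas. The choice [True] for [P]
    gives the usual theorem; isolation gives a substructure with isolated tuples. *)
Lemma downward_LS L (A : structure L) (P : forall n, set ('I_n -> A))
    n0 (v0 : 'I_n0 -> A) :
  P n0 v0 ->
  (forall n (v : 'I_n -> A) (phi : formula L n.+1), P n v ->
     (exists x, holds phi (vcons x v)) ->
     exists2 x, holds phi (vcons x v) & P n.+1 (vcons x v)) ->
  exists (B : structure L) (g : B -> A),
    [/\ countable [set: B],
        forall n (phi : formula L n) v, holds phi v <-> holds phi (g \o v),
        exists w0 : 'I_n0 -> B, g \o w0 = v0
      & forall n (v : 'I_n -> B), exists m (w : 'I_m -> B) (f : 'I_n -> 'I_m),
          P m (g \o w) /\ v = w \o f].
Proof.
move=> P0 step.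
pose e n := sval (cid (countable_enum (inhabits (Bot L n)) (countable_formula L n))).
have eP n (phi : formula L n) : exists j, e n j = phi.
  by rewrite /e; case: cid.
pose Q j (s u : {n & 'I_n -> A}) := (exists x, holds (e (tag s).+1 j) (vcons x (tagged s))) ->
  exists i, holds (e (tag s).+1 j) (vcons (tagged u i) (tagged s)).
have := @requirement_chain {n & 'I_n -> A} (fun s => P _ (tagged s)) (@subtuple A) Q (Tagged _ v0)
  P0 (@subtuple_refl A) (@subtuple_trans A).
case=> [j s t [f sf] Pt|c [c0 cP cle cQ]].
  case: (pselect (exists x, holds (e (tag s).+1 j) (vcons x (tagged s)))).
    (* Renamed to the variables of the current tuple [t], the formula falls under [step], which
       preserves [P]. *)
    case=> x Hx; pose phi := rename (e (tag s).+1 j) (lift_renaming f).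
    have phiE y : holds phi (vcons y (tagged t)) <->
                  holds (e (tag s).+1 j) (vcons y (tagged s)).
      by rewrite /phi holds_rename vcons_lift_renaming -sf.
    have [|y Hy Py] := step _ _ phi Pt; first by exists x; apply/phiE.
    exists (Tagged (fun n => 'I_n -> A) (vcons y (tagged t))); split=> //.
      by exists (lift ord0); apply/funext => i /=; rewrite vcons_lift.
    by move=> _; exists ord0; rewrite /= vcons0; apply/phiE.
  by move=> n; exists t; split=> //; exists id.
pose X a := exists k i, a = tagged (c k) i.
have cover n (v : 'I_n -> {a | X a}) :
    exists k (f : 'I_n -> 'I_(tag (c k))), sval \o v = tagged (c k) \o f.
  by apply: subtuple_cover => // i; apply: svalP (v i).
(* The Tarski-Vaught criterion: the parameters lie in one stage [c k], over which every formula is a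
   requirement. *)
have TV n (v : 'I_n -> {a | X a}) (phi : formula L n.+1) :
    (exists x, holds phi (vcons x (sval \o v))) ->
    exists x : {a | X a}, holds phi (vcons (sval x) (sval \o v)).
  have [k [f ->]] := cover n v.
  have [j jP] := eP _ (rename phi (lift_renaming f)).
  have phiE y : holds (e (tag (c k)).+1 j) (vcons y (tagged (c k))) <->
                holds phi (vcons y (tagged (c k) \o f)).
    by rewrite jP holds_rename vcons_lift_renaming.
  case=> x Hx; have [k' Hk'] := cQ k j.
  have [|i Hi] := Hk'; first by exists x; apply/phiE.
  have Xi : X (tagged (c k') i) by exists k', i.
  by exists (exist _ _ Xi); apply/phiE.
(* The initial tuple may be empty, so an element is obtained as a witness for [Top]. *)
have X_inh : inhabited {a | X a}.
  have v1 : 'I_0 -> {a | X a} by case.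
  have [|x _] := TV _ v1 (Top L 1); last exact: (inhabits x).
  by case: (carrier_inhabited A) => x; exists x.
have X_closed (f : fun_symbol L) (x : 'I_(fun_arity f) -> A) :
    (forall j, X (x j)) -> X (fun_interp x).
  move=> Xx; pose v j : {a | X a} := exist _ _ (Xx j).
  have [|y] := TV _ v (Eq (Var L ord0) (App (fun i => Var L (lift ord0 i)))).
    by exists (fun_interp x); apply/holds_graph.
  by move/holds_graph => <-; apply: svalP y.
pose B := substructure X_inh X_closed.
have evalB n (t : term L n) (v : 'I_n -> B) : sval (eval v t) = eval (sval \o v) t.
  by elim: t => //= f x IH; congr fun_interp; apply/funext => i.
exists B, sval; split.
- apply: (@surj_countable {k & 'I_(tag (c k))} B (fun p =>
      Some (exist X (tagged (c (tag p)) (tagged p))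
            (ex_intro _ (tag p) (ex_intro _ (tagged p) erefl))))).
    move=> [a [k [i ai]]]; exists (Tagged (fun k => 'I_(tag (c k))) i); congr Some.
    by apply: eq_exist => /=.
  exact: countableP.
- move=> n phi; elim: n / phi => [n|n s t|n r x|n p IHp q IHq|n p IHp q IHq
    |n p IHp q IHq|n p IH|n p IH] v //=.
  + by rewrite -!evalB; split=> [->//|]; apply: eq_sig_hprop.
  + suff -> : (fun i => sval (eval v (x i))) = (fun i => eval (sval \o v) (x i)) by [].
    by apply/funext => i; rewrite evalB.
  + by rewrite IHp IHq.
  + by rewrite IHp IHq.
  + by rewrite IHp IHq.
  + split=> [[x /IH]|[x]]; rewrite extendE.
      by rewrite comp_vcons; exists (sval x).
    move=> Hx; have [|y Hy] := TV _ v p; first by exists x.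
    by exists y; apply/IH; rewrite extendE comp_vcons.
  + split=> H x; last by apply/IH; rewrite extendE comp_vcons; apply: H.
    apply: contrapT => nHx; have [|y Hy] := TV _ v (Imp p (Bot L _)).
      by exists x.
    by apply: Hy; rewrite -comp_vcons; apply/IH/H.
- have Xv i : X (v0 i) by exists 0; rewrite c0; exists i.
  by exists (fun i => exist _ _ (Xv i)).
- move=> n v; have [k [f vf]] := cover _ v.
  have Xc i : X (tagged (c k) i) by exists k, i.
  exists (tag (c k)), (fun i => exist _ _ (Xc i)), f; split; first exact: cP.
  apply/funext => i; have := congr1 (fun g => g i) vf.
  by rewrite /=; case: (v i) => a Xa /= aE; subst a; apply: eq_exist.
Qed.

(** * Ultrapowers *)

Section Ultrapower.
Variables (L : language) (A : structure L) (U : set_system nat).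
Context {UU : UltraFilter U}.

Definition ae_eq (f g : nat -> A) : Prop := U [set i | f i = g i].

Lemma ae_eq_refl f : ae_eq f f.
Proof. by apply: filterS filterT. Qed.

Lemma ae_eq_ex f : exists g, ae_eq f g.
Proof. by exists f; apply: ae_eq_refl. Qed.

(* The carrier is made of chosen representatives of the classes modulo [U], so that
   equality in the ultrapower is Leibniz equality. *)
Definition canon f : nat -> A := sval (cid (ae_eq_ex f)).

Lemma ae_canon f : ae_eq f (canon f).
Proof. exact: svalP (cid (ae_eq_ex f)). Qed.

(** Almost equal functions define the same predicate [ae_eq f] by extensionality, and the choice
    depends on nothing else, by proof irrelevance. *)
Lemma canon_eq f g : ae_eq f g -> canon f = canon g.
Proof.
move=> fg; rewrite /canon; move: (ae_eq_ex f) (ae_eq_ex g).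
suff -> : ae_eq f = ae_eq g by move=> p q; rewrite (Prop_irrelevance p q).
apply/predeqP => h.
by split; apply: filterS2 fg => i /= ->.
Qed.

Lemma canonK f : canon (canon f) = canon f.
Proof. by apply/esym/canon_eq/ae_canon. Qed.

Definition ultrapower_inhabited : inhabited {f | canon f = f} :=
  let: inhabits x := carrier_inhabited A in
  inhabits (exist (fun f => canon f = f) _ (canonK (fun=> x))).

Definition ultrapower : structure L :=
  {| carrier := {f | canon f = f};
     carrier_inhabited := ultrapower_inhabited;
     fun_interp := fun f x => exist (fun g => canon g = g) _
       (canonK (fun i => fun_interp (fun j => sval (x j) i)));
     rel_interp := fun r => [set x | U [set i | rel_interp (fun j => sval (x j) i)]] |}.

Definition at_index n (v : 'I_n -> ultrapower) i : 'I_n -> A := fun j => sval (v j) i.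

Lemma at_index_vcons n (x : ultrapower) (v : 'I_n -> ultrapower) i :
  at_index (vcons x v) i = vcons (sval x i) (at_index v i).
Proof. exact: (comp_vcons (fun y : ultrapower => sval y i)). Qed.

Lemma ultrapower_class (f : nat -> A) : exists x : ultrapower, U [set i | f i = sval x i].
Proof.
by exists (exist (fun g => canon g = g) _ (canonK f)); apply: ae_canon.
Qed.

Lemma eval_ultrapower n (t : term L n) (v : 'I_n -> ultrapower) :
  U [set i | eval (at_index v i) t = sval (eval v t) i].
Proof.
elim: t => [i|f x IH]; first exact: ae_eq_refl.
have Ux : U [set i | forall j, eval (at_index v i) (x j) = sval (eval v (x j)) i].
  exact: filter_forall IH.
move: Ux (ae_canon (fun i => fun_interp (fun j => sval (eval v (x j)) i))).
by apply: filterS2 => i /= H <-; congr fun_interp; apply/funext => j; rewrite H.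
Qed.

Lemma ultra_not (X : set nat) : U (~` X) <-> ~ U X.
Proof.
split=> [UnX UX|nUX]; last by case: (in_ultra_setVsetC X UU).
by apply: (filter_not_empty U); move: UX UnX; apply: filterS2.
Qed.

(** Maximality of [U] settles implication and disjunction; witnesses and counterexamples to
    quantifiers are chosen index by index. *)
Lemma Los n (phi : formula L n) (v : 'I_n -> ultrapower) :
  holds phi v <-> U [set i | holds phi (at_index v i)].
Proof.
elim: n / phi v => [n|n s t|n r x|n p IHp q IHq|n p IHp q IHq
  |n p IHp q IHq|n p IH|n p IH] v /=.
- by split=> //; exact: (filter_not_empty U).
- have Us := eval_ultrapower s v; have Ut := eval_ultrapower t v.
  split=> [st|Ust].
    by move: Us Ut; rewrite st; apply: filterS2 => i /= -> ->.
  have : ae_eq (sval (eval v s)) (sval (eval v t)).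
    by move: Us Ut Ust; apply: filterS3 => i /= <- <-.
  move/canon_eq; rewrite (svalP (eval v s)) (svalP (eval v t)).
  by case: (eval v s) (eval v t) => [f cf] [g cg] /= fg; subst g; apply: eq_exist.
- have H : U [set i | forall j, eval (at_index v i) (x j) = sval (eval v (x j)) i].
    by apply: filter_forall => j; apply: eval_ultrapower.
  split; move: H; apply: filterS2 => i /= E; last first.
    by congr (rel_interp _); apply/funext => j; rewrite E.
  by congr (rel_interp _); apply/funext => j; rewrite E.
- rewrite IHp IHq; split=> [H|H Hp]; last by apply: filterS2 H Hp => i; apply.
  case: (in_ultra_setVsetC [set i | holds p (at_index v i)] UU) => [/H|].
    by apply: filterS => i /= Hq _.
  by apply: filterS => i /= np /np.
- by rewrite IHp IHq; split=> [[]|H]; [apply: filterS2|split; apply: filterS H => i []].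
- rewrite IHp IHq; split=> [[]|H].
  + by apply: filterS => i; left.
  + by apply: filterS => i; right.
  apply: contrapT => /not_orP[/ultra_not H1 /ultra_not H2].
  apply: (filter_not_empty U); move: H H1 H2; apply: filterS3 => i.
  by case=> [Hp /(_ Hp)|Hq _ /(_ Hq)].
- split=> [[x /IH]|H].
    by apply: filterS => i /=; rewrite extendE at_index_vcons; exists (sval x i).
  have /choice[f fP] i : exists a, (exists x, holds p (extend x (at_index v i))) ->
      holds p (extend a (at_index v i)).
    case: (pselect (exists x, holds p (extend x (at_index v i)))) => [[x Hx]|nex].
      by exists x.
    by case: (carrier_inhabited A) => a; exists a.
  have [x fx] := ultrapower_class f; exists x; apply/IH.
  move: H fx; apply: filterS2 => i /= /fP + fx.
  by rewrite !extendE at_index_vcons fx.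
- split=> [H|H x]; last first.
    by apply/IH; apply: filterS H => i /=; rewrite extendE at_index_vcons; apply.
  apply: contrapT => /ultra_not nH.
  have /choice[f fP] i : exists a, ~ (forall x, holds p (extend x (at_index v i))) ->
      ~ holds p (extend a (at_index v i)).
    case: (pselect (exists x, ~ holds p (extend x (at_index v i)))) => [[x Hx]|nex].
      by exists x.
    by case: (carrier_inhabited A) => a; exists a => /existsNP.
  have [x fx] := ultrapower_class f; have /IH := H x.
  apply/ultra_not; move: nH fx; apply: filterS2 => i /= /fP + fx.
  by rewrite !extendE at_index_vcons fx.
Qed.

End Ultrapower.

(** * Joint realization of finitely satisfiable formulas *)

Lemma isomorphism_elementary L (A B : structure L) (h : A -> B) :
  isomorphism h ->
  forall n (phi : formula L n) v, holds phi v <-> holds phi (h \o v).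
Proof.
case=> -[g hK gK] hfun hrel n phi.
have hE m (t : term L m) (v : 'I_m -> A) : h (eval v t) = eval (h \o v) t.
  by elim: t => //= f x IH; rewrite hfun; congr fun_interp; apply/funext.
elim: n / phi => [n|n s t|n r x|n p IHp q IHq|n p IHp q IHq
  |n p IHp q IHq|n p IH|n p IH] v //=.
- by rewrite -!hE; split=> [->//|]; apply: can_inj hK _ _.
- rewrite hrel.
  suff -> : (fun i => h (eval v (x i))) = (fun i => eval (h \o v) (x i)) by [].
  by apply/funext.
- by rewrite IHp IHq.
- by rewrite IHp IHq.
- by rewrite IHp IHq.
- split=> -[x Hx].
    by exists (h x); rewrite extendE -comp_vcons -IH.
  by exists (g x); rewrite IH extendE comp_vcons gK.
- split=> H x; last by rewrite IH extendE comp_vcons; apply: H.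
  by rewrite -[x]gK extendE -comp_vcons -IH; apply: H.
Qed.

Lemma aleph0_categorical_realizes L (A : structure L) n (phi : nat -> formula L n) :
  aleph0_categorical A ->
  (forall m, exists v : 'I_n -> A, forall j, j < m -> holds (phi j) v) ->
  exists v : 'I_n -> A, forall j, holds (phi j) v.
Proof.
move=> [_ catA] /choice[v vP].
(* [U] contains all cofinite sets: [phi j] holds at [v m] for every [m > j], hence almost
   everywhere. *)
have [U [UU sU]] := ultraFilterLemma eventually_filter.
have /choice[w wP] : forall j, exists x : ultrapower A (U := U), U [set m | v m j = sval x m].
  by move=> j; apply: ultrapower_class.
have w_phi j : holds (phi j) w.
  apply/Los; have : U [set m | forall i, v m i = sval (w i) m].
    exact: filter_forall wP.
  have : U [set m | j < m] by apply: sU; exists j.+1.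
  apply: filterS2 => i /= ji vE; rewrite (_ : at_index w i = v i); first exact: vP.
  by apply/funext => k; rewrite vE.
have [n' u psi _ [x Hx]|B [g [cB gE [w0 gw0] _]]] :=
    @downward_LS _ (ultrapower A (U := U)) (fun n v => True) _ w I.
  by exists x.
have [//|chi e f|h h_iso] := catA B.
  rewrite gE Los.
  (* A sentence has the same truth value at all indices. *)
  have -> : (fun i => holds chi (at_index (g \o f) i)) = (fun=> holds chi e).
    by apply/funext => i; congr (holds chi _); apply/funext => -[].
  by split=> [H|/filter_const //]; apply: filterS filterT => i _.
have [[k _ kK] _ _] := h_iso; exists (k \o w0) => j.
rewrite (isomorphism_elementary h_iso).
have -> : h \o (k \o w0) = w0 by apply/funext => i /=; rewrite kK.
by rewrite gE gw0.
Qed.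

(** * Finiteness of the number of types *)

Section Types.
Variables (L : language) (A : structure L).

Definition same_type n (v w : 'I_n -> A) : Prop :=
  forall phi : formula L n, holds phi v <-> holds phi w.

Definition isolates n (theta : formula L n) (v : 'I_n -> A) : Prop :=
  holds theta v /\ forall w, holds theta w -> same_type v w.

Definition isolated n (v : 'I_n -> A) : Prop := exists theta, isolates theta v.

(** The isolating formula says that some realization of [theta], held by the [m] bound variables, is
    reindexed by [f] to the given tuple. *)
Lemma isolated_subtuple n m (v : 'I_m -> A) (f : 'I_n -> 'I_m) :
  isolated v -> isolated (v \o f).
Proof.
move=> [theta [theta_v theta_type]].
pose graph := \big[@And L _/Top L _]_(i < n)
  Eq (Var L (rshift m i)) (Var L (lshift n (f i))).
exists (exists_prefix (And (rename theta (@lshift m n)) graph)); split.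
  apply/holds_exists_prefix.
  exists (fun i => match split i with inl j => v j | inr j => v (f j) end).
    apply/funext => j /=; case: splitP => k /= kj; last first.
      by congr (v (f _)); apply/val_inj/eqP; rewrite -(eqn_add2l m) kj.
    by have := ltn_ord k; rewrite -kj -ltn_subRL subnn.
  have splitl j : split (lshift n j) = inl j.
    by rewrite -[lshift n j]/(unsplit (inl j)) unsplitK.
  have splitr j : split (rshift m j) = inr j :> 'I_m + 'I_n.
    by rewrite -[rshift m j]/(unsplit (inr j)) unsplitK.
  split; last by apply/holds_bigAnd => i /=; rewrite splitl splitr.
  apply/holds_rename; move: theta_v; congr (holds theta _).
  by apply/funext => j /=; rewrite splitl.
move=> w /holds_exists_prefix[u <- [/holds_rename theta_u /holds_bigAnd gu]] phi.
have := theta_type _ theta_u (rename phi f); rewrite !holds_rename => ->.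
suff -> : (u \o @lshift m n) \o f = u \o @rshift m n by [].
by apply/funext => i; have /= := gu i.
Qed.

Hypothesis A_cat : aleph0_categorical A.

Lemma tuples_enum n : exists t : nat -> 'I_n -> A, forall v, exists j, t j = v.
Proof.
apply: countable_enum; first by case: (carrier_inhabited A) => x; exact: inhabits (fun=> x).
by apply: countable_tuples; case: A_cat.
Qed.

(* Otherwise a decreasing sequence of satisfiable formulas could avoid the members of
   an enumeration of [A ^ n] one after the other, although [A] satisfies it jointly. *)
Lemma isolated_dense n (phi : formula L n) :
  (exists v : 'I_n -> A, holds phi v) ->
  exists2 v : 'I_n -> A, holds phi v & isolated v.
Proof.
move=> phi_sat; apply: contrapT => no_isolated.
have [t tP] := tuples_enum n.
pose good (psi : formula L n) := (exists v : 'I_n -> A, holds psi v) /\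
  forall v : 'I_n -> A, holds psi v -> holds phi v.
have /choice[nxt nxtP] (p : formula L n * nat) : exists psi,
    good p.1 -> [/\ good psi, forall v : 'I_n -> A, holds psi v -> holds p.1 v
                 & ~ holds psi (t p.2)].
  case: p => psi i /=; case: (pselect (good psi)) => [gpsi|]; last by exists psi.
  have [[v Hv] psi_phi] := gpsi.
  case: (pselect (holds psi (t i))) => [Ht|]; last by exists psi.
  (* As [psi] does not isolate [t i], it holds at some [w] of another type. Adding [chi] or its
     negation, whichever holds at [w], excludes [t i]. *)
  have [w [chi [Hw tw]]] : exists (w : 'I_n -> A) (chi : formula L n),
      holds psi w /\ (holds chi (t i) <-> ~ holds chi w).
    apply: contrapT => none; apply: no_isolated; exists (t i); first exact: psi_phi.
    exists psi; split=> // w Hw chi; apply: contrapT => diff.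
    apply: none; exists w, chi; split=> //; split=> [H1 H2|H2]; first by apply: diff; split.
    by apply: contrapT => H1; apply: diff; split.
  case: (pselect (holds chi w)) => cw.
    exists (And psi chi) => _; split.
    - by split=> [|u [/psi_phi]]; first exists w.
    - by move=> u [].
    - by move=> [_ /tw].
  exists (And psi (Imp chi (Bot L n))) => _; split.
  - by split=> [|u [/psi_phi]]; first exists w.
  - by move=> u [].
  - by move=> [_]; apply; apply/tw.
pose fix psi k := if k is k'.+1 then nxt (psi k', k') else phi.
have psi_good k : good (psi k).
  by elim: k => [|k /(nxtP (psi k, k))[]] //; split.
have psi_dec j k (v : 'I_n -> A) : j <= k -> holds (psi k) v -> holds (psi j) v.
  elim: k => [|k IH]; first by rewrite leqn0 => /eqP ->.
  rewrite leq_eqVlt => /predU1P[-> //|/IH H].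
  by have [_ H' _] := nxtP (psi k, k) (psi_good k); move=> /H'.
have [m|v Hv] := @aleph0_categorical_realizes L A n psi A_cat.
  have [[v Hv] _] := psi_good m.
  by exists v => j /ltnW jm; apply: psi_dec Hv.
have [j jv] := tP v.
by have [_ _] := nxtP (psi j, j) (psi_good j); apply; rewrite /= jv; apply: (Hv j.+1).
Qed.

(* [A] is isomorphic to an elementary substructure all of whose tuples are isolated. *)
Lemma aleph0_categorical_isolated n (v : 'I_n -> A) : isolated v.
Proof.
have [x0] := carrier_inhabited A.
have [|k u phi [chi [chi_u chi_type]] [x Hx]|B [g [cB gE _ Bcover]]] :=
    @downward_LS L A (fun n v => isolated v) 0 (fun=> x0).
- exists (Top L 0); split=> // w _.
  by have -> : w = (fun=> x0) by apply/funext => -[].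
(* Density gives an isolated [y] satisfying [phi], whose tail has the type of [u] by [chi]. Hence
   [Ex (And theta phi)] also holds at [u], and its witness [z] extends [u] itself. *)
- have [|y [/holds_rename chi_y phi_y] [theta [theta_y theta_type]]] :=
    @isolated_dense _ (And (rename chi (lift ord0)) phi).
    exists (vcons x u); split=> //; apply/holds_rename.
    by move: chi_u; congr (holds chi _); apply/funext => i /=; rewrite vcons_lift.
  have yE : y = vcons (y ord0) (y \o lift ord0).
    by apply/funext => i; case: (unliftP ord0 i) => [j|] ->; rewrite ?vcons_lift ?vcons0.
  have [z [theta_z phi_z]] : holds (Ex (And theta phi)) u.
    by apply/(chi_type _ chi_y); exists (y ord0); rewrite extendE -yE.
  exists z => //; exists theta; split=> // w theta_w psi.
  by rewrite -(theta_type _ theta_z) (theta_type _ theta_w).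
have [//|chi e f|h /isomorphism_elementary hE] := A_cat.2 B.
  by rewrite gE; have -> : g \o f = e by apply/funext => -[].
have [m [w [f [iso_w hv]]]] := Bcover n (h \o v).
have [theta [theta_v theta_type]] : isolated (g \o (h \o v)).
  by rewrite hv; apply: isolated_subtuple iso_w.
(* The same formula isolates [v], since [g \o h] is an elementary embedding of [A] into itself. *)
exists theta; split=> [|u]; first by rewrite hE gE.
by rewrite hE gE => theta_u chi; rewrite !hE !gE; apply: theta_type.
Qed.

(** If no initial segment of the enumeration met all types, some tuple would satisfy no isolating
    formula [chi j], although it is itself some [t j]. *)
Lemma finitely_many_types n : exists m (t : 'I_m -> 'I_n -> A),
  forall v, exists i, same_type (t i) v.
Proof.
have [t tP] := tuples_enum n.
have /choice[chi chiP] j := aleph0_categorical_isolated (t j).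
apply: contrapT => none.
have [m|v Hv] :=
    @aleph0_categorical_realizes L A n (fun j => Imp (chi j) (Bot L n)) A_cat.
  apply: contrapT => nv; apply: none; exists m, (fun j => t j) => v.
  apply: contrapT => nt; apply: nv; exists v => j jm /= Hj; apply: nt.
  by exists (Ordinal jm); apply: (chiP j).2.
have [j jv] := tP v; apply: (Hv j); rewrite -jv; exact: (chiP j).1.
Qed.

End Types.

(** * Positive Horn formulas in the periodic power *)

Lemma homomorphism_eval L (A B : structure L) (h : A -> B) : homomorphism h ->
  forall n (t : term L n) v, h (eval v t) = eval (h \o v) t.
Proof.
move=> [hfun _] n; elim=> //= f x IH v.
by rewrite hfun; congr fun_interp; apply/funext => i; apply: IH.
Qed.

(** Surjectivity serves the universal quantifier: each [y] is met as some [h x]. *)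
Lemma surjective_homomorphism_positive_horn L (A B : structure L) (h : A -> B) :
  homomorphism h -> (forall y, exists x, h x = y) ->
  forall n (phi : formula L n) v, positive_horn phi ->
    holds phi v -> holds phi (h \o v).
Proof.
move=> h_hom h_surj n phi; have hE := homomorphism_eval h_hom.
elim: n / phi => [n|n s t|n r x|n p IHp q IHq|n p IHp q IHq
  |n p IHp q IHq|n p IH|n p IH] v //=.
- by rewrite -!hE => _ ->.
- move=> _ /h_hom.2; congr (rel_interp _).
  by apply/funext => i; rewrite hE.
- by move=> /andP[pp pq] [Hp Hq]; split; [apply: IHp|apply: IHq].
- move=> pp [x Hx]; exists (h x); rewrite extendE -comp_vcons.
  exact: IH.
- move=> pp H y; have [x <-] := h_surj y; rewrite extendE -comp_vcons.
  exact/IH/H.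
Qed.

Lemma positive_horn_bigAnd L n (I : finType) (F : I -> formula L n) :
  (forall i, positive_horn (F i)) ->
  positive_horn (\big[@And L n/Top L n]_i F i).
Proof. by move=> FP; elim/big_ind: _ => //= p q -> ->. Qed.

Section PeriodicPowers.
Variables (L : language) (A : structure L).
Local Notation Aper := (periodic_power A).

Definition coordinate n (v : 'I_n -> Aper) (i : nat) : 'I_n -> A :=
  fun j => sval (v j) i.

Lemma periodic_power_inj (x y : Aper) : sval x = sval y -> x = y.
Proof. by case: x y => [f pf] [g pg] /= fg; subst g; apply: eq_exist. Qed.

Lemma coordinate_vcons n (x : Aper) (v : 'I_n -> Aper) i :
  coordinate (vcons x v) i = vcons (sval x i) (coordinate v i).
Proof. exact: (comp_vcons (fun y : Aper => sval y i)). Qed.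

Lemma projection_periomorphism i :
  periomorphism (fun x : Aper => sval x i) /\
  forall a, exists x : Aper, sval x i = a.
Proof.
split=> [|a]; first by split=> // r x; apply.
have pa : periodic A (fun=> a) by exists 1.
by exists (exist _ _ pa).
Qed.

Lemma common_period n (v : 'I_n -> Aper) :
  exists2 p, 0 < p & forall i, coordinate v i = coordinate v (i %% p).
Proof.
have /choice[k kP] : forall j, exists k, 0 < k /\
    forall i, sval (v j) i = sval (v j) (i %% k).
  by move=> j; have [k k0 kE] := svalP (v j); exists k.
exists (\prod_j k j); first by apply: prodn_gt0 => j; case: (kP j).
move=> i; apply/funext => j; rewrite /coordinate; have [_ kE] := kP j.
by rewrite kE [RHS]kE modn_dvdm // (bigD1 j) //= dvdn_mulr.
Qed.

Lemma eval_coordinate n (t : term L n) (v : 'I_n -> Aper) i :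
  sval (eval v t) i = eval (coordinate v i) t.
Proof. exact: homomorphism_eval (projection_periomorphism i).1 _ t v. Qed.

Lemma holds_periodic_power n (phi : formula L n) (v : 'I_n -> Aper) :
  positive_horn phi ->
  holds phi v <-> forall i, holds phi (coordinate v i).
Proof.
move=> phi_ph; split=> [H i|].
  have [hom surj] := projection_periomorphism i.
  exact: (surjective_homomorphism_positive_horn hom surj).
elim: n / phi phi_ph v => [n|n s t|n r x|n p IHp q IHq|n p IHp q IHq
  |n p IHp q IHq|n p IH|n p IH] //= phi_ph v.
- move=> H; apply: periodic_power_inj; apply/funext => i.
  by rewrite !eval_coordinate.
- move=> H i; move: (H i); congr (rel_interp _).
  by apply/funext => j; rewrite eval_coordinate.
- move/andP: phi_ph => [pp pq] H.
  by split; [apply: IHp|apply: IHq] => // i; case: (H i).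
(* Witnesses chosen along one common period of [v] and then repeated form a periodic element. *)
- move=> /choice[w wP]; have [k k0 kE] := common_period v.
  have pw : periodic A (fun i => w (i %% k)) by exists k => // i; rewrite modn_mod.
  exists (exist _ _ pw); rewrite extendE; apply: IH => // i.
  by rewrite coordinate_vcons kE; apply: wP.
- move=> H x; rewrite extendE; apply: IH => // i.
  by rewrite coordinate_vcons; apply: H.
Qed.

(** A periodic function is determined by the finite word of its values over one period. *)
Lemma countable_periodic_power : countable [set: A] -> countable [set: Aper].
Proof.
move=> /countable_seq; have /choice[k kP] : forall x : Aper, exists k,
    0 < k /\ forall i, sval x i = sval x (i %% k).
  by move=> x; have [k k0 kE] := svalP x; exists k.
apply: (@inj_countable _ _ (fun x => mkseq (sval x) (k x))) => x y xy.
have kxy : k x = k y by move/(congr1 size): xy; rewrite !size_mkseq.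
apply: periodic_power_inj.
apply/funext => i; have [k0 ->] := kP x; have [_ ->] := kP y; rewrite -kxy.
have := congr1 (nth (sval x 0) ^~ (i %% k x)) xy.
by rewrite /= !nth_mkseq -?kxy ?ltn_pmod.
Qed.

(** * Back-and-forth between the periodic power and the structure *)

Hypothesis A_cat : aleph0_categorical A.

(** For each of the finitely many types at which some member of [Phi] fails, one failing member is
    kept; their conjunction implies all of [Phi]. *)
Lemma positive_horn_conjunction n (Phi : set (formula L n)) :
  (forall phi, Phi phi -> positive_horn phi) ->
  exists2 psi : formula L n, positive_horn psi &
    forall v : 'I_n -> A, holds psi v <-> forall phi, Phi phi -> holds phi v.
Proof.
move=> Phi_ph; have [m [t tP]] := finitely_many_types A_cat n.
have /choice[F FP] : forall i, exists phi : formula L n, [/\ positive_horn phi,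
    forall v : 'I_n -> A, (forall chi, Phi chi -> holds chi v) -> holds phi v
  & (exists2 chi, Phi chi & ~ holds chi (t i)) -> ~ holds phi (t i)].
  move=> i; case: (pselect (exists2 chi, Phi chi & ~ holds chi (t i))).
    by case=> chi Pchi Hchi; exists chi; split=> //; [apply: Phi_ph|move=> v; apply].
  by move=> n0; exists (Top L n); split.
exists (\big[@And L n/Top L n]_i F i).
  by apply: positive_horn_bigAnd => i; case: (FP i).
move=> v; rewrite holds_bigAnd; split=> [H chi Pchi|H i]; last first.
  by have [_ + _] := FP i; apply.
have [i iv] := tP v; apply: contrapT => nchi; have [_ _ Fi] := FP i.
by apply: Fi; [exists chi => //; rewrite iv|rewrite iv].
Qed.

(** The invariant of the back-and-forth, in one direction only because it is to yield a
    homomorphism. *)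
Definition transfers n (v : 'I_n -> Aper) (w : 'I_n -> A) : Prop :=
  forall phi : formula L n, positive_horn phi -> holds phi v -> holds phi w.

Lemma transfers_forth n (v : 'I_n -> Aper) (w : 'I_n -> A) :
  transfers v w -> forall x, exists y, transfers (vcons x v) (vcons y w).
Proof.
move=> vw x; have [|psi psi_ph psiP] := @positive_horn_conjunction _
    [set phi | positive_horn phi /\ holds phi (vcons x v)].
  by move=> phi [].
have [y Hy] : holds (Ex psi) w.
  (* The equivalence [psiP] concerns tuples of [A], so [psi] is verified coordinate by
     coordinate. *)
  apply: vw => //=; exists x; rewrite extendE; apply/holds_periodic_power => // i.
  by apply/psiP => phi [pphi /holds_periodic_power]; apply.
by exists y => phi pphi Hphi; move/psiP: Hy; apply.
Qed.

(* On consecutive blocks of length a common period of [v], take constant values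
   realizing, with some coordinate of [v], each of the finitely many types available:
   a positive Horn property of the resulting element holds universally over [v]. *)
Lemma transfers_back n (v : 'I_n -> Aper) (w : 'I_n -> A) :
  transfers v w -> forall y, exists x, transfers (vcons x v) (vcons y w).
Proof.
move=> vw y; have [p p0 pE] := common_period v.
have [m [t tP]] := finitely_many_types A_cat n.+1.
have [i0 _] := tP (vcons y w).
have m0 : 0 < m by apply: leq_trans (ltn_ord i0).
have /choice[a aP] : forall i, exists a : A,
    (exists b j, same_type (t i) (vcons b (coordinate v j))) ->
    exists j, same_type (t i) (vcons a (coordinate v j)).
  move=> i; case: (pselect (exists b j, same_type (t i) (vcons b (coordinate v j)))).
    by case=> b [j bj]; exists b => _; exists j.
  by exists y.
pose x q := a (Ordinal (ltn_pmod (q %/ p) m0)).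
have px : periodic A x.
  exists (m * p) => [|q]; first by rewrite muln_gt0 m0.
  by congr a; apply: val_inj; rewrite /= -modn_divl modn_mod.
exists (exist _ _ px) => phi pphi /holds_periodic_power Hphi.
suff: holds (All phi) w by apply.
apply: vw => //; apply/holds_periodic_power => // j b.
have [i ib] := tP (vcons b (coordinate v j)).
have [|k ik] := aP i; first by exists b, j.
apply/(ib phi)/(ik phi).
(* The index [i * p + k %% p] lies in block [i], where [x] takes the value [a i], and is congruent
   to [k] modulo [p]. *)
have := Hphi pphi (i * p + k %% p); rewrite coordinate_vcons /= [coordinate v _]pE.
rewrite modnMDl modn_mod -pE /x.
rewrite (_ : Ordinal _ = i) //; apply: val_inj.
by rewrite /= divnMDl // divn_small ?ltn_pmod // addn0 modn_small.
Qed.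

Lemma periomorphism_extension n (v : 'I_n -> Aper) (w : 'I_n -> A) :
  transfers v w ->
  exists h : Aper -> A,
    [/\ periomorphism h, forall y, exists x, h x = y & w = h \o v].
Proof.
move=> vw; have [eA eAP] := countable_enum (carrier_inhabited A) A_cat.1.
have [eP ePP] := countable_enum (periodic_inhabited A) (countable_periodic_power A_cat.1).
pose P (s : {n & 'I_n -> Aper * A}) := transfers (fst \o tagged s) (snd \o tagged s).
(* Even requirements put every periodic function into the domain, odd ones every element of [A] into
   the range. *)
pose Q j (s u : {n & 'I_n -> Aper * A}) := if odd j
  then exists i, (tagged u i).2 = eA j./2 else exists i, (tagged u i).1 = eP j./2.
have := @requirement_chain _ P (@subtuple (Aper * A)) Q
  (Tagged (fun n => 'I_n -> Aper * A) (fun i => (v i, w i))) vw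
  (@subtuple_refl _) (@subtuple_trans _).
case=> [j s t st Pt|c [c0 cP cle cQ]].
  have [z [Pz Qz]] : exists z, transfers (vcons z.1 (fst \o tagged t))
      (vcons z.2 (snd \o tagged t)) /\ if odd j then z.2 = eA j./2 else z.1 = eP j./2.
    case: (odd j); first by have [x Hx] := transfers_back Pt (eA j./2); exists (x, eA j./2).
    by have [y Hy] := transfers_forth Pt (eP j./2); exists (eP j./2, y).
  exists (Tagged (fun n => 'I_n -> Aper * A) (vcons z (tagged t))); split.
  - by rewrite /P /= !comp_vcons.
  - by exists (lift ord0); apply/funext => i /=; rewrite vcons_lift.
  - by rewrite /Q /=; move: Qz; case: (odd j) => <-; exists ord0; rewrite vcons0.
pose G (z : Aper * A) := exists k i, z = tagged (c k) i.
have G_transfers m (z : 'I_m -> Aper * A) :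
    (forall i, G (z i)) -> transfers (fst \o z) (snd \o z).
  move=> /(subtuple_cover cle)[k [f ->]] phi pphi Hphi.
  have /= := cP k (rename phi f); rewrite positive_horn_rename !holds_rename.
  exact.
(* [G] is functional because equality is positive Horn: [x = x] transfers to [y = y']. *)
have G_fun x y y' : G (x, y) -> G (x, y') -> y = y'.
  move=> Gy Gy'; pose z (i : 'I_2) := if i == ord0 then (x, y) else (x, y').
  have := @G_transfers _ z _ (Eq (Var L ord0) (Var L ord_max)) isT erefl; apply.
  by move=> i; rewrite /z; case: ifP.
have /choice[h hP] : forall x, exists y, G (x, y).
  move=> x; have [j <-] := ePP x; have [k] := cQ 0 j.*2.
  rewrite /Q odd_double doubleK => -[i <-].
  by exists (tagged (c k) i).2, k, i; case: (tagged (c k) i).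
exists h; split.
- split=> [f x|r x].
    pose z := vcons (fun_interp x, h (fun_interp x)) (fun i => (x i, h (x i))).
    have := @G_transfers _ z _ (Eq (Var L ord0) (App (fun i => Var L (lift ord0 i)))) isT.
    rewrite /z !comp_vcons !holds_graph.
    apply=> // i; case: (unliftP ord0 i) => [j|] ->; rewrite ?vcons_lift ?vcons0; exact: hP.
  move=> Hx; apply: (@G_transfers _ (fun i => (x i, h (x i))) _ (Rel (fun i => Var L i)) isT Hx).
  by move=> i; apply: hP.
- move=> y; have [j <-] := eAP y; have [k] := cQ 0 j.*2.+1.
  rewrite /Q /= odd_double uphalf_double => -[i <-].
  exists (tagged (c k) i).1; apply: G_fun (hP _) _.
  by exists k, i; case: (tagged (c k) i).
- apply/funext => i; apply: G_fun (hP _).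
  by exists 0; rewrite c0; exists i.
Qed.

End PeriodicPowers.

(** * The smallest positive Horn definable relation *)

Theorem theorem7p1 (L : language) (A : structure L)
    (hA : aleph0_categorical A) (l : nat) (R : set ('I_l -> A)) :
  smallest_positive_horn_definable R
    [set b : 'I_l -> A |
      exists (k : nat) (k_gt0 : (0 < k)%N) (a : 'I_k -> 'I_l -> A),
        (forall i, R (a i)) /\ surjective_periomorphic_image k_gt0 a b].
Proof.
set S := [set b | _].
have S_min phi : positive_horn phi -> R `<=` [set v | holds phi v] ->
    S `<=` [set v | holds phi v].
  move=> pphi R_phi b [k [k0 [a [Ra [h [h_hom h_surj ->]]]]]] /=.
  apply: (surjective_homomorphism_positive_horn h_hom h_surj) => //.
  by apply/holds_periodic_power => // i; exact: R_phi (Ra _).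
split; last first.
- by move=> _ [phi pphi ->]; apply: S_min.
(* The projection to coordinate 0 sends the constant words on [a] back to [a]. *)
- move=> a Ra; exists 1, isT, (fun=> a); split=> //.
  have [hom surj] := projection_periomorphism A 0.
  by exists (fun x => sval x 0).
have [|psi psi_ph psiP] := @positive_horn_conjunction _ _ hA _
    [set phi | positive_horn phi /\ R `<=` [set v | holds phi v]].
  by move=> phi [].
exists psi => //; apply/seteqP; split=> [b Sb|b].
  by apply/psiP => phi [pphi Rphi]; apply: S_min Sb.
move=> /= /psiP psi_b.
(* If [R] were empty, [Bot] would be among the positive Horn formulas true on [R], and [b] would
   satisfy it. *)
have [a0 Ra0] : exists a, R a.
  apply: contrapT => R0; apply: (psi_b (Bot L l)); split=> // a Ra.
  by apply: R0; exists a.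
have [m [t tP]] := finitely_many_types hA l.
have [i0 _] := tP a0; have m0 : 0 < m by apply: leq_trans (ltn_ord i0).
(* One representative in [R] for each type met by [R]; the other indices get the default [a0]. *)
have /choice[a aP] : forall i, exists a, R a /\
    ((exists2 c, R c & same_type (t i) c) -> same_type (t i) a).
  move=> i; case: (pselect (exists2 c, R c & same_type (t i) c)) => [[c Rc tc]|nc].
    by exists c.
  by exists a0; split.
exists m, m0, a; split; first by move=> i; case: (aP i).
have [|h [h_hom h_surj bE]] := @periomorphism_extension _ _ hA _
    (fun j => periodic_word m0 (a^~ j)) b.
  (* Coordinate [i] of the words is [a i], so a positive Horn formula true of the words holds at all
     representatives, hence on all of [R], hence at [b]. *)
  move=> phi pphi /holds_periodic_power H; apply: psi_b; split=> // c Rc /=.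
  have [i ic] := tP c; have [_ ai] := aP i.
  rewrite -ic ai; last by exists c.
  have := H pphi i; congr (holds phi _); apply/funext => j /=.
  rewrite /coordinate /=; congr (a _ j); apply: val_inj.
  by rewrite /= modn_small.
by exists h.
Qed.
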